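(* Let $G$ and $H$ be graphs. Let $\mathcal{H}$ be the family of all subgraphs of $G$ which are $H$-colourable. Then $$\mathrm{C}(G;H)= \sigma_{\mathcal{H}}(G).$$
   Context: ''Graph'' means either an undirected graph (loops allowed) or a directed graph (a set of vertices with a binary relation), without multiple edges; $G$ and $H$ are of the same kind, and $H$ has nonempty vertex set. A homomorphism $f:G\to H$ is a map $f:V(G)\to V(H)$ with $f(u)f(v)\in E(H)$ whenever $uv\in E(G)$; a graph is $H$-colourable if it admits a homomorphism to $H$. A subgraph of $G$ is a graph whose vertex and edge sets are subsets of $V(G)$, $E(G)$. The union $G_1\cup\cdots\cup G_k$ has vertex set $\bigcup_i V(G_i)$ and edge set $\bigcup_i E(G_i)$. The hom-complexity $\mathrm{C}(G;H)$ is the least positive integer $k$ such that there are subgraphs $G_1,\dots,G_k$ of $G$ with $G=G_1\cup\cdots\cup G_k$ and, for each $i$, a homomorphism $G_i\to H$; $\mathrm{C}(G;H)=\infty$ if no such $k$ exists. A family $\{G_1,\dots,G_k\}$ of subgraphs of $G$ is an edge covering of $G$ if $E(G)=\bigcup_i E(G_i)$ (no condition on vertex sets). For a family $\mathcal{S}$ of subgraphs of $G$, the $\mathcal{S}$-covering number $\sigma_{\mathcal{S}}(G)$ is the least positive integer $k$ such that $G$ has an edge covering with $k$ elements $\{G_1,\dots,G_k\}$ with each $G_i\in\mathcal{S}$; $\sigma_{\mathcal{S}}(G)=\infty$ if no such $k$ exists. *)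

(* Defs.v *)
From mathcomp Require Import all_boot.
From mathcomp Require Import boolp classical_sets functions cardinality.
From mathcomp Require Import constructive_ereal.

Set Implicit Arguments.
Unset Strict Implicit.
Unset Printing Implicit Defensive.

Local Open Scope classical_set_scope.

Variant kind := Undirected | Directed.

(* The vertex set may be infinite or empty. An undirected edge uv is encoded
   by the two ordered pairs (u, v) and (v, u). *)
Record graph (kd : kind) (T : Type) := Graph {
  vset : set T;
  eset : set (T * T);
  eset_sub : eset `<=` vset `*` vset;
  eset_sym : kd = Undirected -> forall u v, eset (u, v) -> eset (v, u)
}.

Section Graphs.
Variable kd : kind.

Definition is_hom (T U : Type) (G : graph kd T) (H : graph kd U)
    (f : vset G -> vset H) : Prop :=
  forall u v : vset G,
    eset G (val u, val v) -> eset H (val (f u), val (f v)).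

Definition colourable (T U : Type) (H : graph kd U) (G : graph kd T) : Prop :=
  exists f : vset G -> vset H, is_hom f.

Definition subgraph (T : Type) (K G : graph kd T) : Prop :=
  vset K `<=` vset G /\ eset K `<=` eset G.

Section Union.
Variables (T I : Type) (F : I -> graph kd T).

Let V := \bigcup_i vset (F i).
Let E := \bigcup_i eset (F i).

Lemma gunion_sub : E `<=` V `*` V.
Proof. by move=> e [i _ /eset_sub[e1 e2]]; split; exists i. Qed.

Lemma gunion_sym : kd = Undirected -> forall u v, E (u, v) -> E (v, u).
Proof. by move=> kdU u v [i _ uv]; exists i => //; exact: eset_sym uv. Qed.

Definition gunion : graph kd T := Graph gunion_sub gunion_sym.

End Union.

(* The values are 1, 2, ... and +oo; -oo is never taken. *)
Definition least_pos (P : nat -> Prop) : \bar nat :=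
  match pselect (exists k, `[< (0 < k)%N /\ P k >]) with
  | left exP => EFin (ex_minn exP)
  | right _ => +oo%E
  end.

Definition hom_complexity (T U : Type) (G : graph kd T) (H : graph kd U) :
    \bar nat :=
  least_pos (fun k => exists F : 'I_k -> graph kd T,
    [/\ forall i, subgraph (F i) G,
        G = gunion F &
        forall i, colourable H (F i)]).

Definition edge_covering (T : Type) (G : graph kd T)
    (A : set (graph kd T)) : Prop :=
  (forall K, A K -> subgraph K G) /\ eset G = \bigcup_(K in A) eset K.

(* A covering with k elements is a set of exactly k distinct subgraphs, whereas
   hom_complexity uses indexed families, where repetitions are allowed. *)
Definition covering_number (T : Type) (S : set (graph kd T))
    (G : graph kd T) : \bar nat :=
  least_pos (fun k => exists A : set (graph kd T),
    [/\ (A #= `I_k)%card, edge_covering G A & A `<=` S]).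

Definition colourable_subgraphs (T U : Type) (G : graph kd T)
    (H : graph kd U) : set (graph kd T) :=
  [set K | subgraph K G /\ colourable H K].

End Graphs.

(* Main.v *)
Require Import Defs.
From mathcomp Require Import all_boot.
From mathcomp Require Import boolp classical_sets functions cardinality.
From mathcomp Require Import constructive_ereal.

(** Discarding repetitions turns an indexed family of [k] subgraphs into a set
    of at most [k] of them. Conversely, adding every vertex of [G] as an isolated
    vertex keeps a subgraph [H]-colourable, since [H] has a vertex to which the
    new vertices can be sent; hence an edge covering can be enlarged to a family
    whose union is [G]. *)

Set Implicit Arguments.
Unset Strict Implicit.
Unset Printing Implicit Defensive.

Local Open Scope classical_set_scope.

(** The bound [m <= k], rather than [m = k], leaves room for families that shrink once repetitions
    are dropped. Each minimum then bounds the other, and the value [+oo] occurs on both sides or on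
    neither. *)
Lemma eq_least_pos (P Q : nat -> Prop) :
  (forall k, (0 < k)%N -> P k -> exists2 m, (0 < m <= k)%N & Q m) ->
  (forall k, (0 < k)%N -> Q k -> exists2 m, (0 < m <= k)%N & P m) ->
  least_pos P = least_pos Q.
Proof.
move=> PQ QP; rewrite /least_pos.
case: pselect => [exP|nP]; case: pselect => [exQ|nQ] //.
- congr EFin; case: ex_minnP => p /asboolP[p0 Pp] pmin.
  case: ex_minnP => q /asboolP[q0 Qq] qmin.
  have [a /andP[a0 ap] Qa] := PQ _ p0 Pp.
  have [b /andP[b0 bq] Pb] := QP _ q0 Qq.
  apply/eqP; rewrite eqn_leq; apply/andP; split.
    by apply: leq_trans bq; apply: pmin; apply/asboolP.
  by apply: leq_trans ap; apply: qmin; apply/asboolP.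
- case: nQ; case: exP => k /asboolP[k0 Pk].
  have [m /andP[m0 _] Qm] := PQ _ k0 Pk.
  by exists m; apply/asboolP.
- case: nP; case: exQ => k /asboolP[k0 Qk].
  have [m /andP[m0 _] Pm] := QP _ k0 Qk.
  by exists m; apply/asboolP.
Qed.

Lemma graph_eq (kd : kind) (T : Type) (G K : graph kd T) :
  vset G = vset K -> eset G = eset K -> G = K.
Proof.
case: G K => [V E sE yE] [V' E' sE' yE'] /= eV eE.
by subst V' E'; congr Graph; exact: Prop_irrelevance.
Qed.

Section Spanning.
Variables (kd : kind) (T : Type) (G K : graph kd T).

Lemma spanning_sub : eset G `&` eset K `<=` vset G `*` vset G.
Proof. by move=> e [/eset_sub]. Qed.

Lemma spanning_sym : kd = Undirected ->
  forall u v, (eset G `&` eset K) (u, v) -> (eset G `&` eset K) (v, u).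
Proof. by move=> kdU u v [Guv Kuv]; split; exact: eset_sym. Qed.

(* Intersecting with [eset G] makes this a subgraph of [G] for every [K]. *)
Definition spanning : graph kd T := Graph spanning_sub spanning_sym.

Lemma spanning_subgraph : subgraph spanning G.
Proof. by split => // e []. Qed.

Lemma colourable_spanning (U : Type) (H : graph kd U) :
  vset H !=set0 -> colourable H K -> colourable H spanning.
Proof.
move=> [h Hh] [f fhom].
pose g (v : vset spanning) : vset H :=
  if pselect (vset K (val v)) is left Kv then f (SigSub (mem_set Kv))
  else SigSub (mem_set Hh).
(* Both ends of an edge of [spanning] lie in [vset K], so [g] agrees with [f] there and the default
   vertex [h] never meets an edge. *)
exists g => u v /= [_ Kuv]; have /= [Ku Kv] := eset_sub Kuv.
rewrite /g; case: pselect => // Ku'; case: pselect => // Kv'.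
exact: fhom.
Qed.

End Spanning.

Lemma card_ord_range (T : Type) (k : nat) (F : 'I_k -> T) : (0 < k)%N ->
  exists2 m, (0 < m <= k)%N & (range F #= `I_m)%card.
Proof.
move=> k0; have leFk : (range F #<= `I_k)%card.
  by rewrite (card_le_eqr card_II); exact: card_image_le.
have [m Fm] : finite_set (range F) by apply/finite_set_leP; exists k.
exists m => //; apply/andP; split; last first.
  by rewrite -card_le_II -(card_le_eql Fm).
(* The range is nonempty because [0 < k] supplies an index. *)
rewrite lt0n; apply/eqP => m0; move: Fm; rewrite m0 II0 card_eq0.
by move=> /eqP F0; have : range F (F (Ordinal k0)) by []; rewrite F0.
Qed.

Lemma card_eq_II_range (T : Type) (k : nat) (A : set T) :
  (A #= `I_k)%card -> exists F : 'I_k -> T, range F = A.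
Proof.
move=> /card_bijP[f [g fK _]]; exists (fun i => val (g (ordII i))).
apply/seteqP; split => [_ [i _ <-]|x Ax]; first exact/set_mem/valP.
exists (IIord (f (SigSub (mem_set Ax)))) => //.
by rewrite IIordK fK.
Qed.

Theorem proposition4p2 (kd : kind) (T U : Type) (G : graph kd T)
    (H : graph kd U) (H_nonempty : vset H !=set0) :
  hom_complexity G H = covering_number (colourable_subgraphs G H) G.
Proof.
apply: eq_least_pos => k k0.
  move=> [F [FG GF Fcol]]; have [m mk Fm] := card_ord_range F k0.
  exists m => //; exists (range F); split => //.
  - split; first by move=> _ [i _ <-].
    by rewrite bigcup_image {1}GF.
  - by move=> _ [i _ <-]; split.
move=> [A [/card_eq_II_range[F FA] [_ GA] AS]].
(* Distinct members of [A] with the same edges have the same [spanning] graph; an indexed family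
   tolerates this, so [k] is kept. *)
exists k; first by rewrite k0 leqnn.
have AF i : A (F i) by rewrite -FA; exists i.
exists (fun i => spanning G (F i)); split.
- by move=> i; exact: spanning_subgraph.
- apply: graph_eq; apply/seteqP.
    (* Each [spanning] graph has all vertices of [G], so one index suffices. *)
    by split => [v Gv|v [i _]//]; exists (Ordinal k0).
  split => [e Ge|e [i _ []]//]; have : eset G e by [].
  by rewrite {1}GA -FA bigcup_image => -[i _ Fie]; exists i.
- move=> i; have [_ Fcol] := AS _ (AF i).
  exact: colourable_spanning.
Qed.
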